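(* Let $\lambda\in(-\infty,1]\setminus\{0\}$, $n\in\mathbb N$ with $n\ge1$, and let $\mu_0$ be a non-negative Radon measure on $(0,+\infty)$ with $\mu_0\in\mathcal M^+_\lambda\cap\mathcal M^+_{2\lambda}$. Suppose that $\mu_0$ is either atomless or discrete (meaning $\mathrm{supp}(\mu_0)\subset\mathbb N=\{1,2,\dots\}$). Then there exists a non-negative measure $\mu^n_0$ of the form $\frac1n\sum_{i=1}^{N_n}\delta_{x_i}$ (with $N_n$ a finite non-negative integer and $x_i\in(0,+\infty)$) such that $$d_\lambda(\mu^n_0,\mu_0)\le\frac{C_\lambda}{\sqrt n},$$ where the constant $C_\lambda$ depends only on $\lambda$ and $M_{2\lambda}(\mu_0)$. Moreover $$M_\alpha(\mu^n_0)\le M_\alpha(\mu_0)$$ for all $\alpha\le0$ if $\lambda\in(-\infty,0)$, and for all $\alpha\ge0$ if $\lambda\in(0,1]$. Furthermore, if $M_0(\mu_0)<+\infty$, then $N_n\le n\,M_0(\mu_0)$.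
   Context: $\mathcal M^+$ is the set of non-negative Radon measures on $(0,+\infty)$. For $\alpha\in\mathbb R$, $M_\alpha(\mu)=\int_0^{+\infty}x^\alpha\mu(dx)\in[0,+\infty]$ and $\mathcal M^+_\alpha=\{\mu\in\mathcal M^+:M_\alpha(\mu)<+\infty\}$. For $\mu,\tilde\mu\in\mathcal M^+_\lambda$, $d_\lambda(\mu,\tilde\mu)=\int_0^{+\infty}x^{\lambda-1}|E(x)|\,dx$, where $E(x)=\mu((0,x])-\tilde\mu((0,x])$ if $\lambda<0$ and $E(x)=\mu((x,+\infty))-\tilde\mu((x,+\infty))$ if $\lambda\in(0,1]$. *)

(* Defs.v *)
From mathcomp Require Import all_boot all_order all_algebra.
From mathcomp Require Import all_classical all_reals all_analysis.
Import Order.TTheory GRing.Theory Num.Theory.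
Import numFieldNormedType.Exports.

Set Implicit Arguments.
Unset Strict Implicit.
Unset Printing Implicit Defensive.

Local Open Scope classical_set_scope.
Local Open Scope ring_scope.
Local Open Scope ereal_scope.

(* A measure on (0,+oo) is encoded as a Borel measure on R that vanishes
   outside the half-line; the Radon condition is local finiteness inside
   (0,+oo) only, so mass may accumulate at 0 and at +oo. (Inner and outer
   regularity are automatic on an open subset of the line.) *)
Definition radon_pos (R : realType)
    (mu : {measure set (measurableTypeR R) -> \bar R}) : Prop :=
  mu (~` `]0%R, +oo[) = 0 /\
  forall K : set R, compact K -> K `<=` `]0%R, +oo[ -> mu K < +oo.

Definition moment (R : realType)
    (mu : {measure set (measurableTypeR R) -> \bar R}) (alpha : R) : \bar R :=
  \int[mu]_(x in `]0%R, +oo[) (x `^ alpha)%:E.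

Definition Mplus (R : realType) (alpha : R)
    (mu : {measure set (measurableTypeR R) -> \bar R}) : Prop :=
  radon_pos mu /\ moment mu alpha < +oo.

(* The intended range is lambda <= 1, lambda != 0, with mu and nu in
   [Mplus lambda]; the two values subtracted are then finite for x > 0. *)
Definition discrepancy (R : realType) (lambda : R)
    (mu nu : {measure set (measurableTypeR R) -> \bar R}) (x : R) : \bar R :=
  if (lambda < 0)%R then mu `]0%R, x]%classic - nu `]0%R, x]%classic
  else mu `]x, +oo[%classic - nu `]x, +oo[%classic.

Definition dist (R : realType) (lambda : R)
    (mu nu : {measure set (measurableTypeR R) -> \bar R}) : \bar R :=
  \int[lebesgue_measure]_(x in `]0%R, +oo[)
    ((x `^ (lambda - 1))%:E * `| discrepancy lambda mu nu x |).

Definition atom d (T : measurableType d) (R : realType)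
    (mu : {measure set T -> \bar R}) (A : set T) : Prop :=
  [/\ measurable A, 0 < mu A &
      forall B, measurable B -> B `<=` A -> mu B < mu A -> mu B = 0].

Definition atomless d (T : measurableType d) (R : realType)
    (mu : {measure set T -> \bar R}) : Prop :=
  forall A, ~ atom mu A.

(* The support is taken in the space (0,+oo), hence the condition 0 < x. *)
Definition supp (R : realType)
    (mu : {measure set (measurableTypeR R) -> \bar R}) : set R :=
  [set x : R | (0 < x)%R /\ forall U : set R, open U -> U x -> 0 < mu U].

Definition discrete (R : realType)
    (mu : {measure set (measurableTypeR R) -> \bar R}) : Prop :=
  supp mu `<=` [set k%:R%R | k in [set k : nat | (1 <= k)%N]].

(* Only x 0, ..., x (N - 1) are used. *)
Definition empirical (R : realType) (n N : nat) (x : nat -> R) :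
    {measure set (measurableTypeR R) -> \bar R} :=
  mscale ((n%:R^-1 : R)%:nng)%R
    (msum (fun i => dirac (x i : measurableTypeR R)) N).

(* Main.v *)
From HB Require Import structures.
Require Import Defs.
From mathcomp Require Import all_boot all_order all_algebra.
From mathcomp Require Import all_classical all_reals all_analysis.
From mathcomp Require Import measurable_realfun ring.
Import Order.TTheory GRing.Theory Num.Theory.
Import numFieldNormedType.Exports.

Set Implicit Arguments.
Unset Strict Implicit.
Unset Printing Implicit Defensive.

Local Open Scope classical_set_scope.
Local Open Scope ring_scope.
Local Open Scope ereal_scope.

(** Let [s y = y `^ lambda] and [K t = mu {y > 0 | t <= s y}], a nonincreasing
    function on (0, +oo).  The sets whose masses enter the distance at [x] are
    (x, +oo) = {s > s x} for [lambda > 0] and (0, x] = {s >= s x} for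
    [lambda < 0], so both signs are one statement about the quantiles of [s].

    The atoms are the first [N] upper [1/n]-quantiles of [s] under [mu]: the
    [i]-th one is [x i = t `^ lambda^-1] for the largest [t] with
    [K t >= (i + 1) / n] ([exists_quantiles]); a jump of [K] makes consecutive
    atoms coincide.  By construction the empirical measure of a set of large [s]
    is at most its [mu]-mass, and it is at least that mass minus [1/n] as long
    as the [N] atoms have not been used up.

    - Since the [i]-th atom is preceded by [(i + 1) / n] of [mu]-mass at larger
      values of [s], integrals of functions nondecreasing in [s], and powers
      [y `^ alpha] with [alpha / lambda >= 0] are such, can only decrease
      ([sum_le_integral]).

    - The discrepancy at [x] is at most [1/n], and also at most
      [K (s x) <= M / s x ^ 2] by Chebyshev's inequality, where [M] bounds the
      moment of order [2 lambda].  Integrating the smaller of the two bounds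
      against [x `^ (lambda - 1)] and switching from one to the other at
      [s x = sqrt (n M)] gives [2 sqrt M / (|lambda| sqrt n)].

    - Using only finitely many atoms spoils the first bound on the region where
      [s] is below a cutoff [delta].  There the discrepancy is at most [K], and
      by Tonelli the function [x `^ (lambda - 1) * K (s x)] has integral at most
      [M_lambda / |lambda|], which is finite, so [delta] can be chosen to
      make this region contribute less than [1 / sqrt n] ([tail_small]). *)

(** * Counting atoms by rank *)

(** If the indices that satisfy [P] all have rank at most [a], there are at most
    [a] of them; the next lemma is the reverse bound, with an error of one. *)
Lemma count_rank_le (R : realType) (P : nat -> bool) (N : nat) (a : R) :
  (0 <= a)%R -> (forall i, (i < N)%N -> P i -> (i.+1%:R <= a)%R) ->
  ((\sum_(i < N) P i)%N%:R <= a)%R.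
Proof.
move=> a0; elim: N => [|N IH] h; first by rewrite big_ord0.
have {}IH := IH (fun i iN => h i (ltnW iN)).
rewrite big_ord_recr/=; case PN: (P N); last by rewrite addn0.
rewrite (le_trans _ (h N (ltnSn N) PN))// ler_nat addn1 ltnS.
have : (\sum_(i < N) P i <= \sum_(i < N) 1)%N.
  by apply: leq_sum => i _; case: (P i).
by rewrite sum1_card card_ord.
Qed.

Lemma count_rank_ge (R : realType) (P : nat -> bool) (N : nat) (a : R) :
  (a <= N.+1%:R)%R -> (forall i, (i < N)%N -> (i.+1%:R < a)%R -> P i) ->
  (a <= (\sum_(i < N) P i)%N%:R + 1)%R.
Proof.
elim: N => [|N IH] aN h; first by rewrite big_ord0 add0r.
have [aN'|Na] := leP a N.+1%:R.
  apply: le_trans (IH aN' (fun i iN => h i (ltnW iN))) _.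
  by rewrite big_ord_recr/= lerD2r ler_nat leq_addr.
rewrite (eq_bigr (fun=> 1%N)) ?sum1_card ?card_ord ?natr1// => i _.
by rewrite h// (le_lt_trans _ Na)// ler_nat.
Qed.

(** * Upper quantiles of a function under a measure *)

Lemma bigcap_measure_ge d (T : measurableType d) (R : realType)
    (mu : {measure set T -> \bar R}) (F : (set T)^nat) (c : \bar R) :
  mu (F 0%N) < +oo -> (forall m, measurable (F m)) -> nonincreasing_seq F ->
  (forall m, c <= mu (F m)) -> c <= mu (\bigcap_m F m).
Proof.
move=> F0 mF niF cF.
have mcap : measurable (\bigcap_m F m) by exact: bigcapT_measurable.
have cv := nonincreasing_cvg_mu F0 mF mcap niF.
rewrite -(cvg_lim _ cv)//; apply: lime_ge.
  by apply/cvg_ex; exists (mu (\bigcap_n F n)).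
by apply: nearW => m; exact: cF.
Qed.

Lemma bigcup_measure_le d (T : measurableType d) (R : realType)
    (mu : {measure set T -> \bar R}) (F : (set T)^nat) (c : \bar R) :
  (forall m, measurable (F m)) -> nondecreasing_seq F ->
  (forall m, mu (F m) <= c) -> mu (\bigcup_m F m) <= c.
Proof.
move=> mF ndF cF.
have cv := nondecreasing_cvg_mu (mu := mu) mF (bigcupT_measurable _ mF) ndF.
rewrite -(cvg_lim _ cv)//; apply: lime_le.
  by apply/cvg_ex; exists (mu (\bigcup_n F n)).
by apply: nearW => m; exact: cF.
Qed.

Definition upset {T : Type} {R : realType} (D : set T) (g : T -> R) (t : R) :=
  D `&` [set y | (t <= g y)%R].

Definition upset_lt {T : Type} {R : realType} (D : set T) (g : T -> R) (t : R) :=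
  D `&` [set y | (t < g y)%R].

Lemma upset_anti (T : Type) (R : realType) (D : set T) (g : T -> R) (s t : R) :
  (s <= t)%R -> upset D g t `<=` upset D g s.
Proof. by move=> st y [Dy /= ty]; split=> //=; exact: le_trans ty. Qed.

Section upsets.
Context d (T : measurableType d) (R : realType) (mu : {measure set T -> \bar R}).
Context (D : set T) (g : T -> R).
Hypotheses (mD : measurable D) (mg : measurable_fun D g).
Hypothesis fin : forall t, (0 < t)%R -> mu (upset D g t) < +oo.

Lemma measurable_upset t : measurable (upset D g t).
Proof.
have := mg mD (measurable_itv `[t, +oo[%R); congr (measurable _).
by apply/seteqP; split=> y [Dy] /=; rewrite in_itv/= andbT.
Qed.

Lemma le_upset (s t : R) : (s <= t)%R -> mu (upset D g t) <= mu (upset D g s).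
Proof.
move=> st; apply: le_measure; rewrite ?inE; try exact: measurable_upset.
exact: upset_anti.
Qed.

Lemma upset_fin_num t : (0 < t)%R -> mu (upset D g t) \is a fin_num.
Proof. by move=> t0; rewrite ge0_fin_numE// fin. Qed.

(** The mass of [t <= g] is left-continuous in [t]; this is what makes the
    supremum defining a quantile a maximum. *)
Lemma upset_left_cts (t : R) c : (0 < t)%R ->
  (forall s, (0 < s < t)%R -> c <= mu (upset D g s)) -> c <= mu (upset D g t).
Proof.
move=> t0 h.
have tm (m : nat) : (0 < t - t / m.+2%:R < t)%R.
  rewrite gtrBl subr_gt0 gtr_pMr// invf_lt1//= ltr1n/=.
  by apply: divr_gt0.
pose F (m : nat) := upset D g (t - t / m.+2%:R)%R.
(* Positive levels increasing to [t], where the mass is finite. *)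
have -> : upset D g t = \bigcap_m F m.
  apply/seteqP; split=> [y ty m _|y Fy].
    by apply: upset_anti ty; have /andP[_ /ltW] := tm m.
  split=> /=; first by have [] := Fy 0%N I.
  rewrite leNgt; apply/negP => gt.
  have e0 : (0 < (t - g y) / t)%R by rewrite divr_gt0// subr_gt0.
  have [m me] := ltr_add_invr e0; rewrite add0r in me.
  have [_ /=] := Fy m I; apply/negP; rewrite -ltNge.
  rewrite ltrBrDl -ltrBrDr mulrC -ltr_pdivlMr//.
  apply: le_lt_trans me; rewrite lef_pV2 ?posrE// ler_nat//.
apply: bigcap_measure_ge.
- by apply: fin; have /andP[] := tm 0%N.
- by move=> m; exact: measurable_upset.
- move=> m p mp; apply/subsetPset/upset_anti.
  by rewrite lerD2l lerN2 ler_pM2l// lef_pV2 ?posrE// ler_nat !ltnS.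
- by move=> m; exact: h.
Qed.

Lemma upset_vanish c : 0 < c -> exists2 b, (0 < b)%R & mu (upset D g b) < c.
Proof.
move=> c0; apply: contrapT => /forall2NP h.
suff : c <= 0 by rewrite leNgt c0.
have <- : mu (\bigcap_(m : nat) upset D g m.+1%:R) = 0.
  rewrite (_ : \bigcap_m _ = set0) ?measure0// -subset0 => y Fy.
  have [_ /=] := Fy (Num.truncn (g y)) I.
  by rewrite leNgt truncnS_gt.
apply: bigcap_measure_ge => //.
- exact: fin.
- by move=> m; exact: measurable_upset.
- by move=> m p mp; apply/subsetPset/upset_anti; rewrite ler_nat ltnS.
- by move=> m; have [//|/negP] := h m.+1%:R; rewrite -leNgt.
Qed.

(** Right continuity of the mass of [t < g], in the form in which it produces a
    quantile strictly above [t]. *)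
Lemma upset_right_cts (t : R) c : c < mu (upset_lt D g t) ->
  exists2 s, (t < s)%R & c < mu (upset D g s).
Proof.
move=> ct; apply: contrapT => /forall2NP h.
move: ct; apply/negP; rewrite -leNgt.
have -> : upset_lt D g t = \bigcup_(m : nat) upset D g (t + m.+1%:R^-1)%R.
  apply/seteqP; split=> [y [Dy /= ty]|y [m _ [Dy /=]]].
    have [m me] := ltr_add_invr ty.
    by exists m => //; split=> //=; exact: ltW.
  by move=> le; split=> //=; apply: lt_le_trans le; rewrite ltrDl invr_gt0.
apply: bigcup_measure_le.
- by move=> m; exact: measurable_upset.
- move=> m p mp; apply/subsetPset/upset_anti.
  by rewrite lerD2l lef_pV2 ?posrE// ler_nat ltnS.
- move=> m; have [|/negP] := h (t + m.+1%:R^-1)%R; last by rewrite -leNgt.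
  by rewrite ltrDl invr_gt0 ltr0n.
Qed.

(** The [i]-th quantile is the largest level above which [g] still has mass
    [(i + 1) / n], hence the equivalence in the conclusion, from which
    everything else about the quantiles follows.  Only those above the cutoff
    [e] are kept: their number [N] is the integer part of [n] times the mass
    above [e], finite even when [mu] is not. *)
Lemma exists_quantiles (n : nat) (e : R) : (0 < n)%N -> (0 < e)%R ->
  exists (N : nat) (t : nat -> R),
    [/\ N%:R%:E <= n%:R%:E * mu (upset D g e),
        n%:R%:E * mu (upset D g e) <= N.+1%:R%:E &
        forall i, (i < N)%N -> (e <= t i)%R /\
          forall s, (0 < s)%R ->
            (s <= t i)%R = (i.+1%:R%:E <= n%:R%:E * mu (upset D g s))].
Proof.
move=> n0 e0; pose k s := n%:R%:E * mu (upset D g s).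
have nk s i : (i%:R%:E <= k s) = ((i%:R / n%:R)%:E <= mu (upset D g s)).
  by rewrite /k -lee_pdivrMl ?ltr0n// mulrC.
have k_anti s s' : (s <= s')%R -> k s' <= k s.
  by move=> ss; rewrite lee_pmul2l ?lte_fin ?ltr0n// le_upset.
have ke_fin : k e \is a fin_num by rewrite fin_numM// upset_fin_num.
pose N := Num.truncn (fine (k e)).
have ke0 : (0 <= fine (k e))%R by rewrite fine_ge0// mule_ge0.
pose S i := [set s : R | (0 < s)%R /\ i.+1%:R%:E <= k s].
exists N, (fun i => sup (S i)); rewrite -/(k e) -(fineK ke_fin) !lee_fin.
split; first by rewrite truncn_le.
  by rewrite ltW// truncnS_gt.
move=> i iN.
have Se : S i e.
  split=> //; rewrite -(fineK ke_fin) lee_fin.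
  by rewrite (le_trans (y := N%:R))// ?ler_nat// truncn_le.
have ubS : has_ubound (S i).
  have [|b b0 bk] := @upset_vanish (i.+1%:R / n%:R)%:E.
    by rewrite lte_fin divr_gt0// ltr0n.
  exists b => s [s0 ks]; rewrite leNgt; apply/negP => bs.
  move: bk; apply/negP; rewrite -leNgt -nk.
  by rewrite (le_trans ks)// k_anti// ltW.
split; first exact: ub_le_sup.
move=> s s0; apply/idP/idP => [ss|ks]; last exact: ub_le_sup.
rewrite -/(k s) nk; apply: upset_left_cts => // s' /andP[s'0 s's]; rewrite -nk.
have [u [u0 ku] s'u] := sup_gt (ex_intro _ e Se) (lt_le_trans s's ss).
by rewrite (le_trans ku)// k_anti// ltW.
Qed.
End upsets.

(** * Comparison of integrals *)

(** If the set where [f] is at least the [i]-th largest value [c i] has mass at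
    least [(i + 1) / n], then [f] integrates to at least the average of the
    [c i] with weights [1 / n].  Induction on the number of values: subtract the
    smallest one, [c N], from all of them, and replace [f] by the positive part
    of [f - c N].  The part removed integrates to at least [c N * mu (B N)],
    which pays for the [N + 1] copies of [c N]. *)
Lemma sum_le_integral d (T : measurableType d) (R : realType)
    (mu : {measure set T -> \bar R}) (D : set T) (B : nat -> set T) (n : nat) :
  measurable D ->
  forall (N : nat) (f : T -> R) (c : nat -> R),
  measurable_fun D f -> (forall y, D y -> (0 <= f y)%R) ->
  (forall i j, (i <= j < N)%N -> (c j <= c i)%R) ->
  (forall i, (i < N)%N ->
    [/\ measurable (B i), B i `<=` D, i.+1%:R%:E <= n%:R%:E * mu (B i),
        (0 <= c i)%R & forall y, B i y -> (c i <= f y)%R]) ->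
  (\sum_(i < N) c i)%R%:E <= n%:R%:E * \int[mu]_(y in D) (f y)%:E.
Proof.
move=> mD; elim=> [|N IH] f c mf f0 c_anti Bc.
  rewrite big_ord0 mule_ge0//; apply: integral_ge0 => y Dy.
  by rewrite lee_fin f0.
have [mB BD muB cN cf] := Bc N (ltnSn N).
pose f' y := Num.max (f y - c N)%R 0%R.
have mf' : measurable_fun D f'.
  by apply: measurable_maxr => //; apply: measurable_funB.
have f'0 y : (0 <= f' y)%R by rewrite le_max lexx orbT.
have {}IH : (\sum_(i < N) (c i - c N))%R%:E
    <= n%:R%:E * \int[mu]_(y in D) (f' y)%:E.
  apply: (IH f' (fun i => c i - c N)%R) => //.
    move=> i j /andP[ij jN]; rewrite lerD2r c_anti// ij/=.
    exact: ltnW.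
  move=> i iN; have [mBi BiD muBi c0 cfi] := Bc i (ltnW iN); split=> //.
    by rewrite subr_ge0 c_anti// ltnS (ltnW iN)/=.
  by move=> y By; rewrite le_max lerD2r cfi.
apply: (@le_trans _ _ (n%:R%:E *
    (\int[mu]_(y in D) (f' y)%:E + \int[mu]_(y in D) ((c N)%:E * (\1_(B N) y)%:E)))).
  have -> : (\sum_(i < N.+1) c i = \sum_(i < N) (c i - c N) + c N * N.+1%:R)%R.
    rewrite big_ord_recr/= sumrB/= sumr_const card_ord -mulr_natr -natr1; ring.
  rewrite EFinD ge0_muleDr; last 2 first.
  - by apply: integral_ge0 => y _; rewrite lee_fin.
  - by apply: integral_ge0 => y _; rewrite mule_ge0// lee_fin.
  rewrite ge0_integralZl//; last exact/measurable_EFinP/measurable_indic.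
  rewrite integral_indic// (setIidl BD) leeD// muleCA EFinM.
  by rewrite lee_wpmul2l.
apply: lee_wpmul2l => //; rewrite -ge0_integralD//.
- apply: ge0_le_integral => //.
  + by move=> y Dy; rewrite adde_ge0// ?mule_ge0// lee_fin.
  + apply: emeasurable_funD; first exact/measurable_EFinP.
    by apply: measurable_funeM; exact/measurable_EFinP/measurable_indic.
  + exact/measurable_EFinP.
  + move=> y Dy; rewrite -EFinM -EFinD lee_fin indicE.
    have [/set_mem By|nBy] := boolP (y \in B N).
      by rewrite mulr1 /f' max_l ?subr_ge0 ?cf// subrK.
    by rewrite mulr0 addr0 /f' ge_max f0// gerBl cN.
- by move=> y _; rewrite lee_fin.
- exact/measurable_EFinP.
- by move=> y _; rewrite mule_ge0// lee_fin.
- by apply: measurable_funeM; exact/measurable_EFinP/measurable_indic.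
Qed.

(** Monotone convergence along the domain of integration. *)
Lemma ge0_integral_bigcup_le d (T : measurableType d) (R : realType)
    (mu : {measure set T -> \bar R}) (F : (set T)^nat) (f : T -> \bar R) c :
  (forall m, measurable (F m)) -> nondecreasing_seq F ->
  measurable_fun (\bigcup_m F m) f ->
  (forall x, (\bigcup_m F m) x -> 0 <= f x) ->
  (forall m, \int[mu]_(x in F m) f x <= c) ->
  \int[mu]_(x in \bigcup_m F m) f x <= c.
Proof.
move=> mF ndF mf f0 h.
have mU : measurable (\bigcup_m F m) by exact: bigcupT_measurable.
pose g m x := (f \_ (F m)) x.
have sub m : F m `<=` \bigcup_k F k by exact: bigcup_sup.
have g0 m x : 0 <= g m x.
  by apply: erestrict_ge0 => y Fy; apply: f0; exact: sub Fy.
have -> : \int[mu]_(x in \bigcup_m F m) f x =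
          \int[mu]_(x in \bigcup_m F m) limn (g ^~ x).
  apply: eq_integral => x /set_mem [k _ Fkx]; apply/esym/cvg_lim => //.
  apply: cvg_near_cst; exists k => // m /= km.
  rewrite /g patchE mem_set//.
  by have /subsetPset := ndF _ _ km; apply.
rewrite monotone_convergence//; last 2 first.
- move=> m; apply/(measurable_restrict _ (mF m) mU).
  apply: measurable_funS mf => //; exact: subIsetl.
- move=> x _ m p mp; rewrite /g !patchE.
  case: ifPn => [xm|_]; last by apply: erestrict_ge0 => y Fy; apply: f0; exact: sub Fy.
  by rewrite ifT//; move: xm; rewrite !inE; have /subsetPset := ndF _ _ mp; apply.
apply: lime_le.
  apply: ereal_nondecreasing_is_cvgn => m p mp.
  apply: ge0_le_integral => //.
  - apply/(measurable_restrict _ (mF m) mU).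
    by apply: measurable_funS mf => //; exact: subIsetl.
  - apply/(measurable_restrict _ (mF p) mU).
    by apply: measurable_funS mf => //; exact: subIsetl.
  - move=> x _; rewrite /g !patchE.
    case: ifPn => [xm|_]; last by apply: erestrict_ge0 => y Fy; apply: f0; exact: sub Fy.
    by rewrite ifT//; move: xm; rewrite !inE; have /subsetPset := ndF _ _ mp; apply.
apply: nearW => m; rewrite /g -integral_mkcondr (setIidr (sub m)).
exact: h.
Qed.

(** Monotonicity without measurability: the integral of a nonnegative function
    is a supremum over the simple functions below it. *)
Lemma ge0_le_integral_dom d (T : measurableType d) (R : realType)
    (mu : {measure set T -> \bar R}) (D : set T) (f1 f2 : T -> \bar R) :
  (forall x, D x -> 0 <= f1 x) -> (forall x, D x -> f1 x <= f2 x) ->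
  \int[mu]_(x in D) f1 x <= \int[mu]_(x in D) f2 x.
Proof.
move=> f10 f12.
have f20 x : D x -> 0 <= f2 x by move=> Dx; exact: le_trans (f10 x Dx) (f12 x Dx).
rewrite !ge0_integralE//; apply: le_ereal_sup => _ [h hf <-]; exists h => //.
by move=> x; apply: le_trans (hf x) _; exact: lee_restrict.
Qed.

(** Chebyshev's inequality. *)
Lemma measure_mul_le_integral d (T : measurableType d) (R : realType)
    (mu : {measure set T -> \bar R}) (D B : set T) (f : T -> \bar R) (c : R) :
  measurable D -> measurable B -> B `<=` D -> measurable_fun D f ->
  (forall y, D y -> 0 <= f y) -> (0 <= c)%R -> (forall y, B y -> c%:E <= f y) ->
  c%:E * mu B <= \int[mu]_(y in D) f y.
Proof.
move=> mD mB BD mf f0 c0 cf; rewrite -integral_cst//.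
apply: le_trans (ge0_subset_integral _ mB mD mf f0 BD).
apply: ge0_le_integral => //.
exact: measurable_funS mf.
Qed.

(** * Integrals of powers *)

Lemma ler_powR_pos (R : realType) (lambda x y : R) :
  (0 < lambda)%R -> (0 < x)%R -> (0 < y)%R ->
  (x `^ lambda <= y `^ lambda)%R = (x <= y)%R.
Proof.
move=> l0 x0 y0; have [xy|yx] := leP x y.
  by rewrite ge0_ler_powR ?nnegrE// ltW.
by apply/negbTE; rewrite -ltNge gt0_ltr_powR// nnegrE ltW.
Qed.

Lemma ler_powR_neg (R : realType) (lambda x y : R) :
  (lambda < 0)%R -> (0 < x)%R -> (0 < y)%R ->
  (x `^ lambda <= y `^ lambda)%R = (y <= x)%R.
Proof.
move=> l0 x0 y0; rewrite -[lambda]opprK !(powRN _ (- lambda)) lef_pV2 ?posrE ?powR_gt0//.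
by rewrite ler_powR_pos// oppr_gt0.
Qed.

Lemma powRVK (R : realType) (lambda t : R) : lambda != 0%R -> (0 <= t)%R ->
  ((t `^ lambda^-1) `^ lambda = t)%R.
Proof. by move=> l0 t0; rewrite -powRrM mulVf// powRr1. Qed.

Lemma measurable_powR_le (R : realType) (a c : R) :
  measurable ([set y | (y `^ a <= c)%R] : set (measurableTypeR R)).
Proof.
have : measurable_fun setT (fun y : measurableTypeR R => y `^ a <= c)%R.
  by apply: measurable_fun_ler => //; exact: measurable_powR.
by move=> /(_ measurableT [set true]); rewrite setTI; exact.
Qed.

Lemma measurable_powR_lt (R : realType) (a c : R) :
  measurable ([set y | (y `^ a < c)%R] : set (measurableTypeR R)).
Proof.
have : measurable_fun setT (fun y : measurableTypeR R => y `^ a < c)%R.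
  by apply: measurable_fun_ltr => //; exact: measurable_powR.
by move=> /(_ measurableT [set true]); rewrite setTI; exact.
Qed.

Lemma integral_powR_itv (R : realType) (lambda a b : R) :
  lambda != 0%R -> (0 < a)%R -> (a < b)%R ->
  \int[lebesgue_measure]_(x in `[a, b]) (x `^ (lambda - 1))%:E =
  ((b `^ lambda - a `^ lambda) / lambda)%:E.
Proof.
move=> l0 a0 ab.
have dF (x : R) : (0 < x)%R ->
    is_derive x 1%R (fun x : R => lambda^-1 * x `^ lambda)%R (x `^ (lambda - 1))%R.
  move=> x0; have H := is_derive1_powR lambda x0.
  apply: is_derive_eq.
  by rewrite /= /GRing.scale/= mulrA mulVf// mul1r.
have cpow r (x : R) : (0 < x)%R -> {for x, continuous (fun x : R => x `^ r)%R}.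
  move=> x0; apply/differentiable_continuous/derivable1_diffP.
  by have H := is_derive1_powR r x0; apply: ex_derive.
have cF (x : R) : (0 < x)%R ->
    {for x, continuous (fun x : R => lambda^-1 * x `^ lambda)%R}.
  move=> x0; apply/differentiable_continuous/derivable1_diffP.
  by have H := dF _ x0; apply: ex_derive.
rewrite (@continuous_FTC2 _ _ (fun x : R => lambda^-1 * x `^ lambda)%R)//.
- by rewrite -EFinB mulrC [in RHS]mulrBl; congr (_ - _)%:E; rewrite mulrC.
- apply: continuous_in_subspaceT => x /set_mem/=; rewrite in_itv/= => /andP[ax _].
  exact/cpow/(lt_le_trans a0).
- split.
  + move=> x; rewrite in_itv/= => /andP[ax _].
    by have H := dF _ (lt_trans a0 ax); apply: ex_derive.
  + exact/cvg_at_right_filter/cF.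
  + exact/cvg_at_left_filter/cF/(lt_trans a0).
- move=> x; rewrite in_itv/= => /andP[ax _].
  by have H := dF _ (lt_trans a0 ax); rewrite derive1E derive_val.
Qed.

(** With [u = t `^ lambda^-1], the domain is (0, u] for [lambda > 0] and [u, +oo)
    for [lambda < 0].  Writing it in terms of [x `^ lambda] gives both signs the
    same bound, and applying the lemma to [- lambda] gives the complementary
    range.  The fundamental theorem of calculus is used on compact
    subintervals, because the integrand may be singular at 0. *)
Lemma integral_powR_sublevel (R : realType) (lambda t : R) :
  lambda != 0%R -> (0 < t)%R ->
  \int[lebesgue_measure]_(x in `]0%R, +oo[ `&` [set x | (x `^ lambda <= t)%R])
    (x `^ (lambda - 1))%:E <= (t / `|lambda|)%:E.
Proof.
move=> l0 t0; pose u := (t `^ lambda^-1)%R.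
have u0 : (0 < u)%R by rewrite powR_gt0.
have ut : (u `^ lambda = t)%R by rewrite powRVK// ltW.
have mpow : measurable_fun setT (fun x : R => (x `^ (lambda - 1))%:E).
  by apply/measurable_EFinP; exact: measurable_powR.
have [l_gt|l_lt|/eqP] := ltgtP 0%R lambda; last by rewrite eq_sym (negbTE l0).
- pose F (k : nat) := `[(u / k.+2%:R)%R, u]%classic.
  have F0 k : (0 < u / k.+2%:R)%R by rewrite divr_gt0.
  have -> : `]0%R, +oo[ `&` [set x | (x `^ lambda <= t)%R] = \bigcup_k F k.
    apply/seteqP; split => x /=.
      rewrite in_itv/= andbT => -[x0]; rewrite -ut ler_powR_pos// => xu.
      have [m me] := ltr_add_invr (divr_gt0 x0 u0); rewrite add0r in me.
      exists m => //; rewrite /F/= in_itv/= xu andbT mulrC -ler_pdivlMr//.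
      by apply: le_trans (ltW me); rewrite lef_pV2 ?posrE// ler_nat.
    move=> [k _]; rewrite /F/= !in_itv/= andbT => /andP[ux xu].
    have x0 := lt_le_trans (F0 k) ux.
    by split=> //; rewrite -ut ler_powR_pos.
  apply: ge0_integral_bigcup_le => //.
  + by move=> m; exact: measurable_itv.
  + move=> m p mp; apply/subsetPset; apply: subset_itvr; rewrite bnd_simp.
    by rewrite ler_pM2l// lef_pV2 ?posrE// ler_nat !ltnS.
  + exact: measurable_funTS.
  + by move=> x _; rewrite lee_fin powR_ge0.
  + move=> m; rewrite /F integral_powR_itv//; last first.
      by rewrite ltr_pdivrMr// ltr_pMr// ltr1n.
    rewrite lee_fin gtr0_norm// ler_pM2r ?invr_gt0// ut.
    by rewrite gerBl powR_ge0.
- pose F (k : nat) := `[u, (u * k.+2%:R)%R]%classic.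
  have -> : `]0%R, +oo[ `&` [set x | (x `^ lambda <= t)%R] = \bigcup_k F k.
    apply/seteqP; split => x /=.
      rewrite in_itv/= andbT => -[x0]; rewrite -ut ler_powR_neg// => ux.
      exists (Num.truncn (x / u)) => //; rewrite /F/= in_itv/= ux/=.
      rewrite mulrC -ler_pdivrMr// (le_trans (ltW (truncnS_gt _)))//.
      by rewrite ler_nat.
    move=> [k _]; rewrite /F/= !in_itv/= andbT => /andP[ux _].
    have x0 := lt_le_trans u0 ux.
    by split=> //; rewrite -ut ler_powR_neg.
  apply: ge0_integral_bigcup_le => //.
  + by move=> m; exact: measurable_itv.
  + move=> m p mp; apply/subsetPset; apply: subset_itvl; rewrite bnd_simp.
    by rewrite ler_pM2l// ler_nat !ltnS.
  + exact: measurable_funTS.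
  + by move=> x _; rewrite lee_fin powR_ge0.
  + move=> m; rewrite /F integral_powR_itv//; last first.
      by rewrite ltr_pMr// ltr1n.
    rewrite lee_fin ltr0_norm// -mulrNN -invrN ler_pM2r ?invr_gt0 ?oppr_gt0//.
    by rewrite opprB ut gerBl powR_ge0.
Qed.

(** * Empirical measures *)

Section empirical.
Context (R : realType) (n N : nat) (x : nat -> R).
Hypothesis n0 : (0 < n)%N.

Lemma empiricalE (A : set R) : measurable (A : set (measurableTypeR R)) ->
  empirical n N x A = ((\sum_(i < N) (x i \in A))%N%:R / n%:R)%:E.
Proof.
move=> mA; rewrite /empirical /mscale /msum /= mulrC EFinM; congr (_ * _).
rewrite natr_sum -sumEFin; exact: eq_bigr.
Qed.

Lemma moment_empirical alpha : (forall i, (i < N)%N -> (0 < x i)%R) ->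
  moment (empirical n N x) alpha = ((\sum_(i < N) x i `^ alpha) / n%:R)%R%:E.
Proof.
move=> x0; have mpos : measurable (`]0%R, +oo[%classic : set (measurableTypeR R)).
  exact: measurable_itv.
have mf : measurable_fun (`]0%R, +oo[%classic : set (measurableTypeR R))
    (fun x : measurableTypeR R => (x `^ alpha)%:E).
  by apply/measurable_EFinP/measurable_funTS; exact: measurable_powR.
rewrite /moment /empirical ge0_integral_mscale//; last first.
  by move=> y _; rewrite lee_fin powR_ge0.
rewrite ge0_integral_measure_sum//; last first.
  by move=> y _; rewrite lee_fin powR_ge0.
rewrite mulrC EFinM; congr (_ * _); rewrite -sumEFin; apply: eq_bigr => i _.
rewrite integral_dirac// diracE mem_set ?mul1e//=.
by rewrite in_itv/= andbT x0.
Qed.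

Context (mu : {measure set (measurableTypeR R) -> \bar R}) (A : set R).
Hypotheses (mA : measurable (A : set (measurableTypeR R))) (muA : mu A < +oo).

Let fA : mu A \is a fin_num. Proof. by rewrite ge0_fin_numE. Qed.

(** The two lemmas below compare the empirical measure of [A] with [mu A] by
    relating the rank of an atom to its membership in [A]. *)
Lemma empirical_le :
  (forall i, (i < N)%N -> A (x i) -> i.+1%:R%:E <= n%:R%:E * mu A) ->
  empirical n N x A <= mu A.
Proof.
move=> h; rewrite empiricalE// -(fineK fA) lee_fin ler_pdivrMr ?ltr0n// mulrC.
apply: (count_rank_le (P := fun i => x i \in A)); first by rewrite mulr_ge0// fine_ge0.
by move=> i iN /set_mem /(h i iN); rewrite -(fineK fA) -EFinM lee_fin.
Qed.

Lemma empirical_ge :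
  n%:R%:E * mu A <= N.+1%:R%:E ->
  (forall i, (i < N)%N -> i.+1%:R%:E < n%:R%:E * mu A -> A (x i)) ->
  mu A <= empirical n N x A + n%:R^-1%:E.
Proof.
rewrite -(fineK fA) -EFinM lee_fin => AN h.
rewrite empiricalE// -EFinD lee_fin -[X in (_ + X)%R]mul1r -mulrDl.
rewrite ler_pdivlMr ?ltr0n// mulrC.
by apply: (count_rank_ge (P := fun i => x i \in A)) => // i iN iA; apply/mem_set/h.
Qed.

End empirical.

(** * Approximation of a measure by its quantiles *)

Section approximation.
Context (R : realType) (mu : {measure set (measurableTypeR R) -> \bar R}).
Context (lambda : R).
Hypotheses (rmu : radon_pos mu) (l0 : lambda != 0%R).

Let pos : set R := `]0%R, +oo[%classic.
Let U t : set R := upset pos (fun y : R => y `^ lambda)%R t.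

Let posE (y : R) : pos y = (0 < y)%R :> Prop.
Proof. by rewrite /pos /= in_itv/= andbT. Qed.

Let mpos : measurable (pos : set (measurableTypeR R)).
Proof. exact: measurable_itv. Qed.

Let mpow (alpha : R) :
  measurable_fun (pos : set (measurableTypeR R))
    (fun y : measurableTypeR R => y `^ alpha : measurableTypeR R)%R.
Proof. by apply: measurable_funTS; exact: measurable_powR. Qed.

Let mpowE (alpha : R) :
  measurable_fun (pos : set (measurableTypeR R))
    (fun y : measurableTypeR R => (y `^ alpha)%:E)%R.
Proof. by apply/measurable_EFinP; exact: mpow. Qed.

Let mU t : measurable (U t : set (measurableTypeR R)).
Proof. by apply: measurable_upset => //; exact: mpow. Qed.

Let Upos t : U t `<=` pos. Proof. by move=> y []. Qed.

Lemma radon_pos_sigma_finite : sigma_finite setT mu.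
Proof.
have [mu0 muK] := rmu.
exists (fun k : nat => ~` pos `|` `[k.+1%:R^-1%R, k.+1%:R%R]%classic).
  apply/esym/seteqP; split=> // x _.
  have [x0|x0] := leP x 0%R.
    by exists 0%N => //; left; rewrite /setC/= posE; apply/negP; rewrite -leNgt.
  have [m me] := ltr_add_invr x0; rewrite add0r in me.
  exists (maxn m (Num.truncn x)) => //; right; rewrite /= in_itv/=; apply/andP; split.
    by apply: le_trans (ltW me); rewrite lef_pV2 ?posrE// ler_nat ltnS leq_maxl.
  by apply: le_trans (ltW (truncnS_gt _)) _; rewrite ler_nat ltnS leq_maxr.
move=> k; have mNpos : measurable (~` pos) by exact: measurableC.
have mitv : measurable `[k.+1%:R^-1%R : R, k.+1%:R%R]%classic by exact: measurable_itv.
split; first exact: measurableU.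
have := measureU2 mu mNpos mitv; move=> /le_lt_trans; apply.
rewrite [X in X + _]mu0 add0e; apply: muK; first exact: segment_compact.
move=> x; rewrite /= !in_itv/= andbT => /andP[+ _]; apply: lt_le_trans.
by rewrite invr_gt0.
Qed.

(** Tonelli for the function [x `^ (lambda - 1)] on the set of pairs [(x, y)] with
    [x `^ lambda <= y `^ lambda]: integrating in [y] first gives the tail, and
    integrating in [x] first gives at most [y `^ lambda / |lambda|]. *)
Lemma tail_tonelli :
  measurable_fun pos (fun x : R => (x `^ (lambda - 1))%:E * mu (U (x `^ lambda)%R)) /\
  \int[lebesgue_measure]_(x in pos) ((x `^ (lambda - 1))%:E * mu (U (x `^ lambda)%R))
    <= (`|lambda|^-1)%:E * moment mu lambda.
Proof.
(* Tonelli needs [mu] as a sigma-finite measure structure. *)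
pose sf := isSFinite.Build _ _ _ _
  (sfinite_measure_sigma_finite radon_pos_sigma_finite).
pose sgf := isSigmaFinite.Build _ _ _ _ radon_pos_sigma_finite.
pose mu' : {sigma_finite_measure set (measurableTypeR R) -> \bar R} :=
  HB.pack (Measure.sort mu) sf sgf.
have int_mu' D h : \int[mu']_(y in D) h y = \int[mu]_(y in D) h y.
  exact: eq_measure_integral.
pose L : {sigma_finite_measure set (measurableTypeR R) -> \bar R} := lebesgue_measure.
pose A := [set p : measurableTypeR R * measurableTypeR R |
  (0 < p.1)%R && (0 < p.2)%R && (p.1 `^ lambda <= p.2 `^ lambda)%R].
pose f (p : measurableTypeR R * measurableTypeR R) : \bar R :=
  ((p.1 `^ (lambda - 1))%:E * (\1_A p)%:E).
have mA : measurable A.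
  have m1 : measurable_fun setT
      (fun p : measurableTypeR R * measurableTypeR R => (0 < p.1)%R).
    exact: measurable_fun_ltr.
  have m2 : measurable_fun setT
      (fun p : measurableTypeR R * measurableTypeR R => (0 < p.2)%R).
    exact: measurable_fun_ltr.
  have m3 : measurable_fun setT (fun p : measurableTypeR R * measurableTypeR R =>
      (p.1 `^ lambda <= p.2 `^ lambda)%R).
    apply: measurable_fun_ler.
      by apply: (measurableT_comp (measurable_powR _)); exact: measurable_fst.
    by apply: (measurableT_comp (measurable_powR _)); exact: measurable_snd.
  have := measurable_and (measurable_and m1 m2) m3.
  by move=> /(_ measurableT [set true]); rewrite setTI; exact.
have f0 p : 0 <= f p by rewrite mule_ge0// lee_fin// powR_ge0.
have mf : measurable_fun setT f.
  apply: emeasurable_funM; apply/measurable_EFinP; last exact: measurable_indic.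
  by apply: (measurableT_comp (measurable_powR _)); exact: measurable_fst.
have FE (x : R) : pos x ->
    fubini_F mu' f x = (x `^ (lambda - 1))%:E * mu (U (x `^ lambda)%R).
  rewrite posE => x0; rewrite /fubini_F int_mu' /f/=.
  rewrite ge0_integralZl//; last 2 first.
  - apply/measurable_EFinP/(measurableT_comp (measurable_indic mA)).
    exact: measurable_pair1.
  - by rewrite lee_fin powR_ge0.
  congr (_ * _); rewrite -(setIT (U _)) -integral_indic//.
  apply: eq_integral => y _; rewrite !indicE; congr ((_ : bool)%:R%:E).
  by apply/idP/idP; rewrite !inE /A/U/upset/= posE x0/= => /andP.
have mF := measurable_fun_fubini_tonelli_F (m2 := mu') f mf f0.
split.
  apply: (eq_measurable_fun (fubini_F mu' f)).
    by move=> x /set_mem; exact: FE.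
  exact: measurable_funTS mF.
rewrite (eq_integral (fubini_F mu' f)); last first.
  by move=> x /set_mem xp; rewrite FE.
apply: (@le_trans _ _ (\int[L]_x fubini_F mu' f x)).
  apply: ge0_subset_integral => //.
  by move=> x _; apply: integral_ge0.
rewrite /fubini_F (fubini_tonelli (m1 := L) (m2 := mu') f)// int_mu' /moment -/pos.
rewrite -ge0_integralZl//; last first.
  by move=> y _; rewrite lee_fin powR_ge0.
rewrite [leRHS]integral_mkcond.
apply: ge0_le_integral => //.
- by move=> y _; apply: integral_ge0.
- exact: (measurable_fun_fubini_tonelli_G (m1 := L) f mf f0).
- apply/(measurable_restrictT _ mpos); apply: measurable_funeM.
  exact: mpowE.
move=> y _; rewrite patchE; case: ifPn => [/set_mem|ny]; last first.
  rewrite integral0_eq// => x _; rewrite /f indicE memNset ?mule0//.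
  move=> /andP[/andP[_ y0] _]; move/negP: ny; apply.
  by rewrite inE posE.
rewrite posE => y0.
rewrite -EFinM mulrC; apply: le_trans (integral_powR_sublevel l0 (powR_gt0 _ y0)).
rewrite [leRHS]integral_mkcond le_eqVlt; apply/predU1P; left.
apply: eq_integral => x _.
rewrite /f/= patchE indicE.
have -> : ((x, y) \in A) = (x \in pos `&` [set x | (x `^ lambda <= y `^ lambda)%R]).
  by apply/idP/idP; rewrite !inE /A/= posE y0 andbT => /andP.
by case: ifP; rewrite ?mule1 ?mule0.
Qed.

(** Dominated convergence: the regions [x `^ lambda < 1 / (k + 1)] decrease to the
    empty set, and the integrand is integrable by [tail_tonelli]. *)
Lemma tail_small (e : R) : moment mu lambda < +oo -> (0 < e)%R ->
  exists2 delta, (0 < delta)%R &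
  \int[lebesgue_measure]_(x in pos `&` [set x | (x `^ lambda < delta)%R])
    ((x `^ (lambda - 1))%:E * mu (U (x `^ lambda)%R)) <= e%:E.
Proof.
move=> Mfin e0; have [mg ig] := tail_tonelli.
set g := fun x => _ in mg ig *.
have g0 x : 0 <= g x by rewrite mule_ge0// lee_fin powR_ge0.
have intg : lebesgue_measure.-integrable pos g.
  apply/integrableP; split=> //.
  under eq_integral do rewrite gee0_abs//.
  apply: le_lt_trans ig _; exact: lte_mul_pinfty.
pose S k := [set x : R | (x `^ lambda < k.+1%:R^-1)%R].
have mS k : measurable (S k : set (measurableTypeR R)).
  exact: measurable_powR_lt.
pose f_ k x := (g \_ (S k)) x.
have mf_ k : measurable_fun pos (f_ k).
  apply/(measurable_restrict _ (mS k) mpos).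
  by apply: measurable_funS mg => //; exact: subIsetr.
have f_0 x : pos x -> f_ ^~ x @ \oo --> 0.
  rewrite posE => x0; apply: cvg_near_cst.
  have [m me] := ltr_add_invr (powR_gt0 lambda x0); rewrite add0r in me.
  exists m => // k /= mk; rewrite /f_ patchE memNset// /S/=.
  apply/negP; rewrite -leNgt; apply: le_trans (ltW me).
  by rewrite lef_pV2 ?posrE// ler_nat ltnS.
have f_g k x : pos x -> `|f_ k x| <= g x.
  by move=> _; rewrite /f_ patchE; case: ifP => _; rewrite ?abse0// gee0_abs.
have [] := @dominated_convergence _ _ _ lebesgue_measure pos mpos f_ (cst 0) g.
- exact: mf_.
- exact: measurable_cst.
- exact: aeW.
- exact: intg.
- by apply: aeW => x k; exact: f_g.
move=> _ _.
rewrite integral0 => /fine_cvgP[fin_f /cvgr0_norm_lt/(_ _ e0) lt_f].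
near \oo => k.
exists (k.+1%:R^-1)%R; first by rewrite invr_gt0.
rewrite integral_mkcondr -/(S k) -/(f_ k) -[leLHS]fineK; last by near: k.
rewrite lee_fin ltW// (le_lt_trans (ler_norm _))//; near: k.
exact: lt_f.
Unshelve. all: by end_near. Qed.

Hypothesis (M1fin : moment mu lambda < +oo).
Hypothesis (M2fin : moment mu (2 * lambda) < +oo).

Lemma upset_moment_le (t : R) : (0 < t)%R ->
  (t ^+ 2)%:E * mu (U t) <= moment mu (2 * lambda).
Proof.
move=> t0; apply: measure_mul_le_integral => //.
- by move=> y _; rewrite lee_fin powR_ge0.
- by rewrite exprn_ge0// ltW.
- move=> y [_ /= ty]; rewrite lee_fin mulrC powRrM powR_mulrn ?powR_ge0//.
  by rewrite ler_sqr ?nnegrE ?powR_ge0// ltW.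
Qed.

Let Ufin (t : R) : (0 < t)%R -> mu (U t) < +oo.
Proof.
move=> t0; have := le_lt_trans (upset_moment_le t0) M2fin.
move: (measure_ge0 mu (U t)); case: (mu (U t)) => [r _ _|_|//]; first exact: ltry.
by rewrite gt0_muley ?lte_fin ?exprn_gt0.
Qed.

(* Adding one makes the crossover level [sqrt (n M)] below positive even when
   [mu] vanishes. *)
Let M : R := fine (moment mu (2 * lambda)) + 1.

Let M0 : (0 < M)%R.
Proof.
rewrite ltr_pwDr// fine_ge0// integral_ge0// => y _.
by rewrite lee_fin powR_ge0.
Qed.

Let U_le (t : R) : (0 < t)%R -> mu (U t) <= (M / t ^+ 2)%:E.
Proof.
move=> t0; have tt : (0 < t ^+ 2)%R by rewrite exprn_gt0.
rewrite EFinM muleC lee_pdivlMl//.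
apply: le_trans (upset_moment_le t0) _.
have fM : moment mu (2 * lambda) \is a fin_num.
  by rewrite ge0_fin_numE// integral_ge0// => y _; rewrite lee_fin powR_ge0.
by rewrite -(fineK fM) lee_fin /M lerDl.
Qed.

(** The set whose masses are compared by [discrepancy] at [y].  For [lambda < 0]
    it consists of the [z] with [z `^ lambda >= y `^ lambda], for [lambda > 0] the
    inequality is strict; the two signs differ in nothing else. *)
Let A (y : R) : set R :=
  if (lambda < 0)%R then `]0%R, y]%classic else `]y, +oo[%classic.

Let mA y : measurable (A y : set (measurableTypeR R)).
Proof. by rewrite /A; case: ifP => _; exact: measurable_itv. Qed.

Let A_neg y : (lambda < 0)%R -> (0 < y)%R -> A y = U (y `^ lambda)%R.
Proof.
move=> ln y0; rewrite /A ln; apply/seteqP; split => z /=.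
  by rewrite in_itv/= => /andP[z0 zy]; split; rewrite ?posE//= ler_powR_neg.
by move=> [+ /=]; rewrite posE in_itv/= => z0; rewrite z0 ler_powR_neg.
Qed.

Let A_pos y : (0 < lambda)%R -> (0 < y)%R ->
  A y = upset_lt pos (fun z : R => z `^ lambda)%R (y `^ lambda)%R.
Proof.
move=> lp y0; rewrite /A ltNge (ltW lp)/=; apply/seteqP; split => z /=.
  rewrite in_itv/= andbT => yz; have z0 := lt_trans y0 yz.
  by split; rewrite ?posE//= ltNge ler_powR_pos// -ltNge.
by move=> [+ /=]; rewrite posE in_itv/= andbT => z0; rewrite ltNge ler_powR_pos// -ltNge.
Qed.

Let lambda_cases : (lambda < 0)%R \/ (0 < lambda)%R.
Proof. by apply/orP; rewrite -neq_lt. Qed.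

Let AU y : (0 < y)%R -> A y `<=` U (y `^ lambda)%R.
Proof.
move=> y0; have [ln|lp] := lambda_cases; first by rewrite A_neg.
by rewrite A_pos// => z [? /= /ltW].
Qed.

Let muAU y : (0 < y)%R -> mu (A y) <= mu (U (y `^ lambda)%R).
Proof. by move=> y0; apply: le_measure; rewrite ?inE//; exact: AU. Qed.

Let muA y : (0 < y)%R -> mu (A y) < +oo.
Proof.
by move=> y0; apply: le_lt_trans (muAU y0) _; rewrite Ufin// powR_gt0.
Qed.

Section quantile_points.
Context (n N : nat) (t : nat -> R) (delta : R).
Hypotheses (n0 : (0 < n)%N) (d0 : (0 < delta)%R).
Hypothesis Nge : n%:R%:E * mu (U delta) <= N.+1%:R%:E.
Hypothesis tE : forall i, (i < N)%N -> (delta <= t i)%R /\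
  forall s, (0 < s)%R ->
    (s <= t i)%R = (i.+1%:R%:E <= n%:R%:E * mu (U s)).

Let x i := (t i `^ lambda^-1)%R.

Let t0 i : (i < N)%N -> (0 < t i)%R.
Proof. by move=> /tE[+ _]; exact: lt_le_trans. Qed.

Let x0 i : (i < N)%N -> (0 < x i)%R.
Proof. by move=> iN; rewrite powR_gt0// t0. Qed.

Let xt i : (i < N)%N -> (x i `^ lambda = t i)%R.
Proof. by move=> iN; rewrite powRVK// ltW// t0. Qed.

(** [alpha / lambda >= 0] says that [y `^ alpha] is a nondecreasing function of
    [y `^ lambda]. *)
Lemma moment_quantiles_le (alpha : R) : (0 <= alpha / lambda)%R ->
  moment (empirical n N x) alpha <= moment mu alpha.
Proof.
move=> b0; rewrite moment_empirical//.
have powE (y : R) : (y `^ alpha = (y `^ lambda) `^ (alpha / lambda))%R.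
  by rewrite -powRrM mulrCA divff// mulr1.
rewrite EFinM muleC lee_pdivrMl ?ltr0n// /moment.
apply: (@sum_le_integral _ _ _ mu pos (fun i => U (t i)) n mpos N
  (fun y => y `^ alpha)%R (fun i => x i `^ alpha)%R).
+ exact: mpow.
+ by move=> y _; rewrite powR_ge0.
+ move=> i j /andP[ij jN]; have iN := leq_ltn_trans ij jN.
  rewrite !powE !xt//; apply: ge0_ler_powR => //;
    [by rewrite nnegrE ltW// t0 ..|].
  rewrite (tE iN).2 ?t0//; apply: le_trans (_ : j.+1%:R%:E <= _).
    by rewrite lee_fin ler_nat ltnS.
  by rewrite -(tE jN).2 ?t0.
+ move=> i iN; split=> //.
  * by rewrite -(tE iN).2 ?t0.
  * by rewrite powR_ge0.
  * move=> y [_ /= ty]; rewrite !powE xt// ge0_ler_powR ?nnegrE ?powR_ge0//.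
    by rewrite ltW// t0.
Qed.

(** The atom of index [i] lies in [A y] only if [A y] has mass [(i + 1) / n]. *)
Let nuA_le y : (0 < y)%R -> empirical n N x (A y) <= mu (A y).
Proof.
move=> y0; apply: empirical_le => //; first exact: muA.
move=> i iN; have [ln|lp] := lambda_cases.
  rewrite A_neg// => -[_ /=]; rewrite xt// (tE iN).2//.
  by rewrite powR_gt0.
rewrite A_pos// => -[_ /=]; rewrite xt// => yt.
have : i.+1%:R%:E <= n%:R%:E * mu (U (t i)) by rewrite -(tE iN).2 ?t0.
move=> /le_trans; apply; apply: lee_wpmul2l => //.
apply: le_measure; rewrite ?inE//; first by rewrite -A_pos.
by move=> z [pz /= tz]; split=> //=; exact: lt_le_trans tz.
Qed.

(** Conversely, mass larger than [(i + 1) / n] forces the atom of index [i] into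
    [A y]; the level [delta] is where the atoms may run out. *)
Let nuA_ge y : (0 < y)%R -> (delta <= y `^ lambda)%R ->
  mu (A y) <= empirical n N x (A y) + n%:R^-1%:E.
Proof.
move=> y0 dy; apply: empirical_ge => //; first exact: muA.
  apply: le_trans Nge; apply: lee_wpmul2l => //.
  apply: le_trans (muAU y0) _; apply: le_measure; rewrite ?inE//.
  exact: upset_anti.
move=> i iN; have [ln|lp] := lambda_cases.
  rewrite A_neg// => /ltW; rewrite -(tE iN).2 ?powR_gt0// => ty.
  by split; rewrite ?posE ?x0//= xt.
rewrite A_pos// => lt_i; have nn : (0 < n%:R :> R)%R by rewrite ltr0n.
(* For the strict inequality, part of the mass has to be found strictly above
   the level of [y]. *)
move: lt_i; rewrite -lte_pdivrMl// => /(upset_right_cts (mu := mu) mpos (mpow lambda)).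
move=> [s ys]; rewrite lte_pdivrMl// => /ltW.
rewrite -(tE iN).2 ?(lt_trans _ ys) ?powR_gt0// => st.
by split; rewrite ?posE ?x0//= xt// (lt_le_trans ys).
Qed.

Let disc_fin y : (0 < y)%R -> exists a b, [/\
  empirical n N x (A y) = a%:E, mu (A y) = b%:E & (0 <= a <= b)%R].
Proof.
move=> y0; rewrite empiricalE//; set a := (_ / _)%R.
exists a, (fine (mu (A y))); split => //; first by rewrite fineK// ge0_fin_numE// muA.
apply/andP; split; first by rewrite divr_ge0.
have := nuA_le y0; rewrite empiricalE// -/a -[X in _ <= X -> _]fineK ?lee_fin//.
by rewrite ge0_fin_numE// muA.
Qed.

Let discE y : discrepancy lambda (empirical n N x) mu y
  = empirical n N x (A y) - mu (A y).
Proof. by rewrite /discrepancy /A; case: ifP. Qed.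

Let disc_U y : (0 < y)%R ->
  `|discrepancy lambda (empirical n N x) mu y| <= mu (U (y `^ lambda)%R).
Proof.
move=> y0; apply: le_trans (muAU y0); rewrite discE.
have [a [b [-> -> /andP[a0 ab]]]] := disc_fin y0.
by rewrite -EFinB lee_fin distrC ger0_norm ?subr_ge0// gerBl.
Qed.

Let disc_n y : (0 < y)%R -> (delta <= y `^ lambda)%R ->
  `|discrepancy lambda (empirical n N x) mu y| <= n%:R^-1%:E.
Proof.
move=> y0 dy; have := nuA_ge y0 dy; rewrite discE.
have [a [b [-> -> /andP[a0 ab]]]] := disc_fin y0.
rewrite -EFinD -EFinB !lee_fin distrC ger0_norm ?subr_ge0//.
by rewrite lerBlDl.
Qed.

(** Here [M] bounds the squared level times the tail, and [e] the contribution of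
    the region beyond the cutoff, where the atoms may have run out. *)
Lemma dist_quantiles_le (e : \bar R) :
  \int[lebesgue_measure]_(y in pos `&` [set y | (y `^ lambda < delta)%R])
    ((y `^ (lambda - 1))%:E * mu (U (y `^ lambda)%R)) <= e ->
  dist lambda (empirical n N x) mu
    <= (2 * Num.sqrt M / (`|lambda| * Num.sqrt n%:R))%:E + e.
Proof.
have s0 : (0 < Num.sqrt n%:R :> R)%R by rewrite sqrtr_gt0 ltr0n.
move=> tail_le; pose T := (Num.sqrt n%:R * Num.sqrt M)%R.
have T0 : (0 < T)%R by rewrite mulr_gt0// sqrtr_gt0.
(* The discrepancy is bounded by [1 / n] below the level [T], by Chebyshev's
   inequality above it, and by the tail below the cutoff. *)
pose g y := (y `^ (lambda - 1))%:E * mu (U (y `^ lambda)%R).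
pose S1 := [set y : R | (y `^ lambda <= T)%R].
pose S2 := [set y : R | (y `^ (- lambda) <= T^-1)%R].
pose S3 := [set y : R | (y `^ lambda < delta)%R].
pose h1 := (fun y : R => (y `^ (lambda - 1))%:E) \_ S1.
pose h2 := (fun y : R => (y `^ (- lambda - 1))%:E) \_ S2.
pose h3 := g \_ S3.
have h10 y : 0 <= h1 y by apply: erestrict_ge0 => z _; rewrite lee_fin powR_ge0.
have h20 y : 0 <= h2 y by apply: erestrict_ge0 => z _; rewrite lee_fin powR_ge0.
have h30 y : 0 <= h3 y.
  by apply: erestrict_ge0 => z _; rewrite mule_ge0// lee_fin powR_ge0.
have nV0 : 0 <= (n%:R^-1 : R)%:E by rewrite lee_fin invr_ge0.
have ME0 : 0 <= M%:E by rewrite lee_fin ltW.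
have bound y : pos y ->
    (y `^ (lambda - 1))%:E * `|discrepancy lambda (empirical n N x) mu y|
    <= n%:R^-1%:E * h1 y + M%:E * h2 y + h3 y.
  rewrite posE => y0; have p0 : (0 : \bar R) <= (y `^ (lambda - 1))%:E.
    by rewrite lee_fin powR_ge0.
  have [yd|dy] := ltP (y `^ lambda)%R delta.
    rewrite -[leLHS]add0e leeD ?adde_ge0 ?mule_ge0//.
    by rewrite /h3 patchE mem_set//; apply: lee_wpmul2l => //; exact: disc_U.
  rewrite -[leLHS]adde0 leeD//.
  have [yT|Ty] := leP (y `^ lambda)%R T.
    rewrite -[leLHS]adde0 leeD ?mule_ge0// /h1 patchE mem_set// muleC.
    by apply: lee_wpmul2r => //; exact: disc_n.
  rewrite -[leLHS]add0e leeD ?mule_ge0// /h2 patchE mem_set; last first.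
    by rewrite /S2/= powRN lef_pV2 ?posrE ?powR_gt0// ltW.
  apply: (@le_trans _ _ ((y `^ (lambda - 1))%:E * (M / (y `^ lambda) ^+ 2)%:E)).
    apply: lee_wpmul2l => //; apply: le_trans (disc_U y0) _.
    by rewrite U_le// powR_gt0.
  rewrite -!EFinM lee_fin !powRD ?(gt_eqF y0) ?implybT//.
  rewrite powRN expr2 invfM le_eqVlt; apply/orP; left; apply/eqP.
  by field; rewrite ?gt_eqF ?powR_gt0.
have mh1 : measurable_fun (pos : set (measurableTypeR R)) h1.
  apply/(measurable_restrict _ (measurable_powR_le lambda T) mpos).
  by apply: measurable_funS (mpowE (lambda - 1)) => //; exact: subIsetr.
have mh2 : measurable_fun (pos : set (measurableTypeR R)) h2.
  apply/(measurable_restrict _ (measurable_powR_le (- lambda) T^-1) mpos).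
  by apply: measurable_funS (mpowE (- lambda - 1)) => //; exact: subIsetr.
have mh3 : measurable_fun (pos : set (measurableTypeR R)) h3.
  apply/(measurable_restrict _ (measurable_powR_lt lambda delta) mpos).
  by apply: measurable_funS tail_tonelli.1 => //; exact: subIsetr.
rewrite /dist -/pos; apply: (@le_trans _ _ (\int[lebesgue_measure]_(y in pos)
    (n%:R^-1%:E * h1 y + M%:E * h2 y + h3 y))).
  apply: ge0_le_integral_dom; last exact: bound.
  by move=> y _; rewrite mule_ge0// lee_fin powR_ge0.
rewrite ge0_integralD//; last 2 first.
+ by move=> y _; rewrite adde_ge0// mule_ge0.
+ by apply: emeasurable_funD; exact: measurable_funeM.
rewrite ge0_integralD//; last 4 first.
+ by move=> y _; rewrite mule_ge0.
+ exact: measurable_funeM.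
+ by move=> y _; rewrite mule_ge0.
+ exact: measurable_funeM.
rewrite !ge0_integralZl// -!integral_mkcondr.
apply: (@le_trans _ _ (n%:R^-1%:E * (T / `|lambda|)%:E
    + M%:E * (T^-1 / `|lambda|)%:E + e)).
  apply: leeD; last exact: tail_le.
  apply: leeD; apply: lee_wpmul2l => //.
    exact: integral_powR_sublevel.
  rewrite -normrN; apply: integral_powR_sublevel; first by rewrite oppr_eq0.
  by rewrite invr_gt0.
rewrite leeD2r// -!EFinM -!EFinD lee_fin le_eqVlt; apply/orP; left; apply/eqP.
have sn : (n%:R = Num.sqrt n%:R * Num.sqrt n%:R :> R)%R by rewrite -expr2 sqr_sqrtr.
have sM : (M = Num.sqrt M * Num.sqrt M)%R by rewrite -expr2 sqr_sqrtr// ltW.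
have sM0 : (0 < Num.sqrt M)%R by rewrite sqrtr_gt0.
rewrite /T {1}sn {2}sM.
by field; rewrite ?normr_eq0 ?l0 ?gt_eqF.
Qed.

End quantile_points.

Lemma exists_approximation (n : nat) : (0 < n)%N ->
  exists (N : nat) (x : nat -> R),
    (forall i, (i < N)%N -> (0 < x i)%R) /\
    dist lambda (empirical n N x) mu
      <= ((2 * Num.sqrt M / `|lambda| + 1) / Num.sqrt n%:R)%:E /\
    (forall alpha : R, (0 <= alpha / lambda)%R ->
       moment (empirical n N x) alpha <= moment mu alpha) /\
    N%:R%:E <= n%:R%:E * moment mu 0%R.
Proof.
move=> n0; have s0 : (0 < Num.sqrt n%:R :> R)%R by rewrite sqrtr_gt0 ltr0n.
have [|delta d0 tail_le] := tail_small (e := (Num.sqrt n%:R)^-1) M1fin.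
  by rewrite invr_gt0.
have [N [t [Nle Nge tE]]] := exists_quantiles mpos (mpow lambda) Ufin n0 d0.
exists N, (fun i => t i `^ lambda^-1)%R; do !split.
- by move=> i /tE[dt _]; rewrite powR_gt0// (lt_le_trans d0).
- apply: le_trans (dist_quantiles_le n0 d0 Nge tE tail_le) _.
  rewrite -EFinD lee_fin le_eqVlt; apply/orP; left; apply/eqP.
  by field; rewrite ?normr_eq0 ?l0 ?gt_eqF.
- by move=> alpha; exact: (moment_quantiles_le n0 d0 tE).
- apply: le_trans Nle _; apply: lee_wpmul2l => //.
  rewrite /moment (eq_integral (cst 1)); last by move=> y _; rewrite powRr0.
  by rewrite integral_cst// mul1e; apply: le_measure; rewrite ?inE.
Qed.

End approximation.

Theorem proposition3p2 (R : realType) :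
  exists C : R -> \bar R -> R,
  forall (lambda : R) (n : nat)
    (mu0 : {measure set (measurableTypeR R) -> \bar R}),
  (lambda <= 1)%R -> lambda != 0%R -> (1 <= n)%N ->
  Mplus lambda mu0 -> Mplus (2 * lambda)%R mu0 ->
  atomless mu0 \/ discrete mu0 ->
  exists (N : nat) (x : nat -> R),
    (forall i, (i < N)%N -> (0 < x i)%R) /\
    dist lambda (empirical n N x) mu0
      <= (C lambda (moment mu0 (2 * lambda)%R) / Num.sqrt n%:R)%:E /\
    ((lambda < 0)%R -> forall alpha : R, (alpha <= 0)%R ->
       moment (empirical n N x) alpha <= moment mu0 alpha) /\
    ((0 < lambda)%R -> forall alpha : R, (0 <= alpha)%R ->
       moment (empirical n N x) alpha <= moment mu0 alpha) /\
    (moment mu0 0%R < +oo -> N%:R%:E <= n%:R%:E * moment mu0 0%R).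
Proof.
exists (fun lambda m => 2 * Num.sqrt (fine m + 1) / `|lambda| + 1)%R.
move=> lambda n mu0 _ l0 n0 [rmu M1] [_ M2] _.
have [N [x [x0 [dist_le [mom_le N_le]]]]] := exists_approximation rmu l0 M1 M2 n0.
exists N, x; do !split => //.
- by move=> ln alpha a0; apply: mom_le; rewrite ler_ndivlMr// mul0r.
- by move=> lp alpha a0; apply: mom_le; rewrite divr_ge0// ltW.
Qed.
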